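(* Let $T_0,\dots,T_{n-1}$ be a Random Forest of $n$ decision trees, each of height at most $h$, and let $X=(x_1,\dots,x_d)$ be an input object to which the algorithm has only quantum oracle access. Let $\hat y_i$ denote the output of tree $T_i$ on $X$, let $R=\frac1n\sum_{i=0}^{n-1}\hat y_i$ be the Random Forest prediction, and let $$\beta=\frac1n\sum_{i=0}^{n-1}\frac{\hat y_i-y_{\min}}{y_{\max}-y_{\min}}\in[0,1],$$ where $y_{\min}<y_{\max}$ are the minimum and maximum leaf labels over all trees. Then for every positive integer $t$ and every $\delta\in(0,1)$: (i) there is a quantum query algorithm that outputs $\tilde\beta$ with $|\tilde\beta-\beta|\le \frac{2\pi}{t}+\frac{\pi^2}{t^2}$ with probability at least $1-\delta$, using $O(t\cdot h\cdot\log\frac1\delta)$ queries to $X$; (ii) there is a quantum query algorithm that outputs $\tilde R$ with $|\tilde R-R|\le (y_{\max}-y_{\min})\left(\frac{2\pi}{T}+\frac{\pi^2}{T^2}\right)$, where $T=\lceil t(y_{\max}-y_{\min})\rceil$, with probability at least $1-\delta$, using $O(t\,(y_{\max}-y_{\min})\cdot h\cdot\log\frac1\delta)$ queries to $X$.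
   Context: An object is $X=(x_1,\dots,x_d)$, each attribute $x_j$ real-valued or taking values in $\{1,\dots,W_j\}$. A decision tree is a rooted tree (here binary, of height at most $h$) in which each inner node is labeled by a condition on a single attribute of the input (e.g. $x_j>\theta$ or $x_j=\theta$ for a constant $\theta$) with two outgoing edges labeled by the outcomes, and each leaf is labeled by a real number. The output of a tree on $X$ is the label of the leaf reached by starting at the root and repeatedly following the edge labeled by the outcome of the current node's condition on $X$. A Random Forest is a finite set of decision trees $\{T_0,\dots,T_{n-1}\}$ and its prediction on $X$ is the average $\frac1n\sum_i \hat y_i$ of the tree outputs. Query model: the input $X$ is accessible only through an oracle unitary $|j\rangle|z\rangle|w\rangle\mapsto|j\rangle|z\oplus x_j\rangle|w\rangle$ (with attribute values encoded in binary); the algorithm alternates input-independent unitaries with oracle calls and ends with a measurement; query complexity is the number of oracle calls. Evaluating the condition at one tree node costs one query. The forest (tree structures, conditions, leaf labels, $y_{\min}$, $y_{\max}$) is fixed and known to the algorithm; $n$ may be assumed a power of two. *)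

(* Defs.v *)
From HB Require Import structures.
From mathcomp Require Import all_boot all_order all_algebra.
From mathcomp Require Import complex.
From mathcomp Require Import reals exp trigo.
From Stdlib Require List.
Set Implicit Arguments. Unset Strict Implicit. Unset Printing Implicit Defensive.
Import Order.TTheory GRing.Theory Num.Theory.
Local Open Scope ring_scope.

Definition attr_val (b : nat) := {ffun 'I_b -> bool}.
Definition object (d b : nat) := {ffun 'I_d -> attr_val b}.

(* Binary decision trees: an inner node carries a condition on a single
   attribute j (a boolean predicate on its value, e.g. x_j > theta or
   x_j = theta); the first subtree is followed when the condition holds,
   the second otherwise. Leaves carry real labels. *)
Inductive dtree (R : Type) (d b : nat) : Type :=
| Leaf of R
| Node of 'I_d & (attr_val b -> bool) & dtree R d b & dtree R d b.

Arguments Leaf {R d b}.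
Arguments Node {R d b}.

Fixpoint dt_eval (R : Type) (d b : nat) (X : object d b) (T : dtree R d b) : R :=
  match T with
  | Leaf y => y
  | Node j c Tl Tr => if c (X j) then dt_eval X Tl else dt_eval X Tr
  end.

Fixpoint dt_height (R : Type) (d b : nat) (T : dtree R d b) : nat :=
  match T with
  | Leaf _ => 0
  | Node _ _ Tl Tr => (maxn (dt_height Tl) (dt_height Tr)).+1
  end.

Fixpoint dt_leaves (R : Type) (d b : nat) (T : dtree R d b) : seq R :=
  match T with
  | Leaf y => [:: y]
  | Node _ _ Tl Tr => dt_leaves Tl ++ dt_leaves Tr
  end.

Section Forest.
Variables (R : realType) (n d b : nat).
Implicit Type F : 'I_n -> dtree R d b.

Definition forest_leaves F : seq R :=
  flatten [seq dt_leaves (F i) | i <- enum 'I_n].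

Definition ymin F : R :=
  \big[Num.min/head 0 (forest_leaves F)]_(y <- forest_leaves F) y.
Definition ymax F : R :=
  \big[Num.max/head 0 (forest_leaves F)]_(y <- forest_leaves F) y.

Definition rf_predict F (X : object d b) : R :=
  n%:R^-1 * \sum_(i < n) dt_eval X (F i).

Definition rf_beta F (X : object d b) : R :=
  n%:R^-1 * \sum_(i < n) ((dt_eval X (F i) - ymin F) / (ymax F - ymin F)).
End Forest.

Section Quantum.
Variables (R : realType) (d b : nat).

(* Basis states: |j>|z>|w> with j an attribute index, z a b-bit register,
   w a basis state of a finite workspace W. *)
Definition qbasis (W : finType) : finType := ('I_d * attr_val b * W)%type.

(* Operators on the (finite-dimensional) state space C^S, as matrices
   indexed by basis states; states are amplitude vectors S -> C. *)
Definition qop (S : finType) := S -> S -> R[i].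
Definition qstate (S : finType) := S -> R[i].

Definition qapply (S : finType) (A : qop S) (psi : qstate S) : qstate S :=
  fun s => \sum_(s' : S) A s s' * psi s'.

(* A is unitary: A^* A = I (equivalently A A^* = I in finite dimension). *)
Definition unitary (S : finType) (A : qop S) : Prop :=
  forall u v : S, \sum_(s : S) conjc (A s u) * A s v = (u == v)%:R.

Definition oracle_map (W : finType) (X : object d b) (s : qbasis W) : qbasis W :=
  let: (j, z, w) := s in (j, [ffun k => z k (+) X j k], w).

Definition oracle (W : finType) (X : object d b) : qop (qbasis W) :=
  fun s s' => (s == oracle_map X s')%:R.

Definition basis_state (S : finType) (s0 : S) : qstate S :=
  fun s => (s == s0)%:R.

Definition sqmod (z : R[i]) : R := complex.Re z ^+ 2 + complex.Im z ^+ 2.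

(* A quantum query algorithm: workspace W, initial basis state s0,
   input-independent unitaries U_0 (qU0) and U_1..U_q (qUs), and a
   classical post-processing of the final computational-basis
   measurement outcome into a real output. It runs
   U_q O_X ... U_1 O_X U_0 |s0> and measures; it makes q = size qUs
   oracle calls. *)
Record qalg : Type := QAlg {
  qW : finType;
  qs0 : qbasis qW;
  qU0 : qop (qbasis qW);
  qUs : seq (qop (qbasis qW));
  qout : qbasis qW -> R
}.
Arguments qs0 : clear implicits.
Arguments qU0 : clear implicits.
Arguments qUs : clear implicits.
Arguments qout : clear implicits.

Definition qalg_wf (A : qalg) : Prop :=
  unitary (qU0 A) /\ List.Forall (@unitary _) (qUs A).

Definition queries (A : qalg) : nat := size (qUs A).

Definition final_state (A : qalg) (X : object d b) : qstate (qbasis (qW A)) :=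
  foldl (fun psi U => qapply U (qapply (oracle X) psi))
        (qapply (qU0 A) (basis_state (qs0 A))) (qUs A).
Arguments final_state : clear implicits.

Definition success_prob (A : qalg) (X : object d b) (P : R -> bool) : R :=
  \sum_(s : qbasis (qW A) | P (qout A s)) sqmod (final_state A X s).
End Quantum.

Arguments qalg R d b : clear implicits.

(* Main.v *)
Require Import Defs.
From HB Require Import structures.
From mathcomp Require Import all_boot all_order all_algebra.
From mathcomp Require Import complex.
From mathcomp Require Import reals exp trigo.
From mathcomp Require Import perm cyclic separable cyclotomic boolp sequences.
From mathcomp Require Import zify ring lra.
Set Implicit Arguments. Unset Strict Implicit. Unset Printing Implicit Defensive.
Import Order.TTheory GRing.Theory Num.Theory.
Local Open Scope ring_scope.
Local Open Scope complex_scope.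

(** Let [u] be the uniform superposition of the trees (with clean work
    registers).  Tracing the [h] nodes of a tree path, reflecting a flag qubit
    by [[c, s], [s, -c]] with [c = 1 - 2 y] for the normalised leaf label [y],
    and untracing is a reflection [Q] with [<u, Q u> = 1 - 2 beta =: c].  With
    [P] the reflection along [u], the walk [W = P Q] satisfies
    [(W + W^-1) u = 2 c u].

    Phase estimation is run once, with a control register in the state [p], the
    normalised coefficients of [(1 + X + ... + X^(t-1))^(k+1)].  After the
    discrete Fourier transform the amplitude of the outcome [z] (a root of
    unity) is [p(z W) u], and [|Re z - c| |v| <= |(1 - z W) v|] on the span of
    the [W^m u].  Hence, by Parseval, the [2k]-th moment of [Re z - c] is at
    most [|(1 - X)^k p|^2 / |p|^2 <= (k+1) (4 / t^2)^k], so that Markov's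
    inequality gives an error probability exponentially small in [k] and no
    median of repeated runs is needed.  The estimate is [(1 - Re z) / 2]. *)

(** * Squared moduli of complex amplitudes *)

Section SquaredModulus.
Variable R : realType.
Implicit Types x y : R[i].

Lemma sqmodE x : (sqmod x)%:C = conjc x * x.
Proof. by case: x => a b; rewrite /sqmod /=; simpc; congr (_ +i* _); ring. Qed.

Lemma sqmod_ge0 x : 0 <= sqmod x.
Proof. by rewrite /sqmod addr_ge0 ?sqr_ge0. Qed.

Lemma sqmodM x y : sqmod (x * y) = sqmod x * sqmod y.
Proof. by case: x y => a b [c d]; rewrite /sqmod /=; ring. Qed.

Lemma sqmod_real (a : R) : sqmod a%:C = a ^+ 2.
Proof. by rewrite /sqmod /= expr0n /= addr0. Qed.

Lemma sqmodB_le x y : sqmod (x - y) <= 2 * sqmod x + 2 * sqmod y.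
Proof.
case: x y => a b [c d]; rewrite /sqmod /= -subr_ge0.
rewrite (_ : _ - _ = (a + c) ^+ 2 + (b + d) ^+ 2); last by ring.
by rewrite addr_ge0 ?sqr_ge0.
Qed.
End SquaredModulus.

(** * Inner products, linear isometries and reflections *)

Section InnerProduct.
Variables (R : realType) (S : finType).
Implicit Types (phi psi : qstate R S) (f g : qstate R S -> qstate R S).

Definition ip phi psi : R[i] := \sum_s conjc (phi s) * psi s.
Definition nrm2 psi : R := \sum_s sqmod (psi s).

Lemma ip_nrm2 psi : ip psi psi = (nrm2 psi)%:C.
Proof. by rewrite /nrm2 rmorph_sum; apply: eq_bigr => s _; rewrite /= sqmodE. Qed.

Lemma nrm2_ge0 psi : 0 <= nrm2 psi.
Proof. by apply: sumr_ge0 => s _; exact: sqmod_ge0. Qed.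

Lemma nrm2Z a psi : nrm2 (fun s => a * psi s) = sqmod a * nrm2 psi.
Proof. by rewrite /nrm2 mulr_sumr; apply: eq_bigr => s _; rewrite sqmodM. Qed.

Lemma nrm2B_le phi psi :
  nrm2 (fun s => phi s - psi s) <= 2 * nrm2 phi + 2 * nrm2 psi.
Proof.
rewrite /nrm2 !mulr_sumr -big_split /=.
by apply: ler_sum => s _; exact: sqmodB_le.
Qed.

Lemma ip_conj phi psi : ip psi phi = conjc (ip phi psi).
Proof.
rewrite /ip rmorph_sum; apply: eq_bigr => s _ /=.
by rewrite rmorphM /= conjcK mulrC.
Qed.

Lemma ip_lin phi a psi chi :
  ip phi (fun s => a * psi s + chi s) = a * ip phi psi + ip phi chi.
Proof.
rewrite /ip mulr_sumr -big_split; apply: eq_bigr => s _ /=; ring.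
Qed.

Lemma ip_basis u psi : ip (basis_state R u) psi = psi u.
Proof.
rewrite /ip (bigD1 u) //= big1 => [|s /negPf su]; rewrite /basis_state.
  by rewrite eqxx addr0 conjc_nat mul1r.
by rewrite su conjc_nat mul0r.
Qed.

Definition qlinear f := forall a phi psi,
  f (fun s => a * phi s + psi s) = (fun s => a * f phi s + f psi s).

Definition isometry f := forall phi psi, ip (f phi) (f psi) = ip phi psi.

Definition lin_isom f := qlinear f /\ isometry f.

Lemma isometry_nrm2 f psi : isometry f -> nrm2 (f psi) = nrm2 psi.
Proof. by move=> isof; apply: complexI; rewrite -!ip_nrm2 isof. Qed.

Lemma lin_isom_id : lin_isom id.
Proof. by []. Qed.

Lemma lin_isom_comp f g : lin_isom f -> lin_isom g -> lin_isom (f \o g).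
Proof.
move=> [lf If] [lg Ig]; split=> [a phi psi|phi psi] /=.
  by rewrite lg lf.
by rewrite If Ig.
Qed.

Lemma qlinearZ f a psi : qlinear f ->
  f (fun s => a * psi s) = (fun s => a * f psi s).
Proof.
move=> lf.
have f0 : f (fun=> 0) = (fun=> 0).
  (* Coefficient [-1] at the zero state reads [f 0 = - f 0 + f 0]. *)
  have := lf (-1) (fun=> 0) (fun=> 0); rewrite (_ : (fun=> _) = (fun=> 0)).
    by move=> ->; apply: funext => s; ring.
  by apply: funext => s; ring.
have := lf a psi (fun=> 0); rewrite f0.
rewrite (_ : (fun s => _ + 0) = (fun s => a * psi s)); last first.
  by apply: funext => s; rewrite addr0.
by move=> ->; apply: funext => s; rewrite addr0.
Qed.

Lemma qlinear_sum f (I : Type) (r : seq I) (a : I -> R[i])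
    (phi : I -> qstate R S) : qlinear f ->
  f (fun s => \sum_(i <- r) a i * phi i s) =
  (fun s => \sum_(i <- r) a i * f (phi i) s).
Proof.
move=> lf; elim: r => [|i r IH].
  have /= := qlinearZ 0 (fun=> 0) lf.
  rewrite (_ : (fun s => 0 * 0) = (fun s => \sum_(i <- [::]) a i * phi i s)).
    by move=> ->; apply: funext => s; rewrite big_nil mul0r.
  by apply: funext => s; rewrite big_nil mul0r.
rewrite (_ : (fun s => _) =
  (fun s => a i * phi i s + \sum_(j <- r) a j * phi j s)).
  by rewrite lf IH; apply: funext => s; rewrite big_cons.
by apply: funext => s; rewrite big_cons.
Qed.

(** The matrix of [f]. Circuits are composed as maps on states and become matrices only when a
    [qalg] is formed. *)
Definition op_of f : qop R S := fun s s' => f (basis_state R s') s.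

Lemma qapply_op_of f psi : qlinear f -> qapply (op_of f) psi = f psi.
Proof.
move=> lf; rewrite [in RHS](_ : psi = fun s => \sum_s' psi s' * basis_state R s' s).
  by rewrite qlinear_sum //; apply: funext => s; apply: eq_bigr => s' _; rewrite mulrC.
apply: funext => s; rewrite (bigD1 s) //= big1 => [|s' /negPf ss'].
  by rewrite /basis_state eqxx mulr1 addr0.
by rewrite /basis_state eq_sym ss' mulr0.
Qed.

Lemma unitary_op_of f : isometry f -> unitary (op_of f).
Proof.
move=> isof u v; have := isof (basis_state R u) (basis_state R v).
by rewrite ip_basis.
Qed.

(** An injection of the finite set [S] into itself permutes the basis; classical reversible steps
    enter the circuit this way. *)
Lemma lin_isom_pullback (g : S -> S) : injective g ->
  lin_isom (fun psi s => psi (g s)).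
Proof.
move=> inj_g; split=> // phi psi.
by rewrite /ip [RHS](reindex_inj inj_g).
Qed.

Definition refl_along (u : qstate R S) psi : qstate R S :=
  fun s => 2 * ip u psi * u s - psi s.

Lemma refl_along_linear u : qlinear (refl_along u).
Proof.
move=> a phi psi; apply: funext => s; rewrite /refl_along ip_lin; ring.
Qed.

Lemma refl_along_isometry u : nrm2 u = 1 -> isometry (refl_along u).
Proof.
(* After expansion the reflection terms collect into a multiple of [ip u u - 1], which vanishes. *)
move=> u1 phi psi; transitivity
  (4 * conjc (ip u phi) * ip u psi * (ip u u - 1) + ip phi psi); last first.
  by rewrite ip_nrm2 u1; ring.
transitivity (\sum_s (4 * conjc (ip u phi) * ip u psi * (conjc (u s) * u s)
   - 2 * conjc (ip u phi) * (conjc (u s) * psi s)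
   - 2 * ip u psi * (conjc (phi s) * u s) + conjc (phi s) * psi s)).
  apply: eq_bigr => s _; rewrite /refl_along !(rmorphB, rmorphM) rmorph_nat /=; ring.
rewrite !big_split /= !sumrN -!mulr_sumr -/(ip u u) -/(ip u psi) -/(ip phi u).
rewrite -/(ip phi psi) (ip_conj u phi); ring.
Qed.

Lemma refl_alongK u : nrm2 u = 1 -> involutive (refl_along u).
Proof.
move=> u1 psi; apply: funext => s; rewrite /refl_along.
have -> : ip u (fun s => 2 * ip u psi * u s - psi s) = ip u psi.
  transitivity (2 * ip u psi * ip u u - ip u psi); last first.
    by rewrite ip_nrm2 u1; ring.
  set a := 2 * _; rewrite /ip mulr_sumr -sumrB; apply: eq_bigr => s' _; ring.
ring.
Qed.

End InnerProduct.

(** * Roots of unity and preparation of the initial state *)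

Lemma complex_prim_root_exists (R : realType) (N : nat) : (0 < N)%N ->
  exists w : R[i], N.-primitive_root w.
Proof.
move=> N0; pose p : {poly R[i]} := 'X^N - 1.
have [r Dp] := closed_field_poly_normal p.
rewrite (monicP _) ?monicXnsubC // scale1r in Dp.
have rN1 : all N.-unity_root r.
  by apply/allP => z; rewrite -root_prod_XsubC -Dp.
have szr : (N < (size r).+1)%N.
  by rewrite -(size_prod_XsubC r id) -Dp size_XnsubC.
(* Among [N] distinct [N]-th roots of unity one is primitive; they are distinct since [N] is nonzero
   in characteristic zero. *)
have [|z _ zN] := hasP (has_prim_root N0 rN1 _ szr); last by exists z.
by rewrite -separable_prod_XsubC -Dp separable_Xn_sub_1 // pnatr_eq0 -lt0n.
Qed.

Lemma unity_root_conj (R : realType) (N : nat) (w : R[i]) :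
  (0 < N)%N -> w ^+ N = 1 -> conjc w * w = 1.
Proof.
move=> N0 wN; rewrite mulrC -sqr_normc.
have /eqP : `|w| ^+ N = 1 by rewrite -normrX wN normr1.
by rewrite pexpr_eq1 // => /eqP ->; rewrite expr1n.
Qed.

(** The sum is geometric; its ratio [z] is an [N]-th root of unity and is 1 only for [m = m']. *)
Lemma prim_root_orthogonal (R : realType) (N : nat) (w : R[i]) (m m' : 'I_N) :
  N.-primitive_root w ->
  \sum_(y < N) conjc (w ^+ (y * m)) * w ^+ (y * m') = (N * (m == m'))%:R.
Proof.
move=> wN; have N0 := prim_order_gt0 wN; have w1 := prim_expr_order wN.
have wV : conjc w = w^-1.
  have w0 : w != 0.
    by apply: contra_eq_neq w1 => ->; rewrite expr0n gtn_eqF // eq_sym oner_eq0.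
  by apply: (mulIf w0); rewrite (unity_root_conj N0 w1) mulVf.
pose z := conjc (w ^+ m) * w ^+ m'.
have -> : \sum_(y < N) conjc (w ^+ (y * m)) * w ^+ (y * m') = \sum_(y < N) z ^+ y.
  apply: eq_bigr => y _; rewrite mulnC exprM (mulnC y) (exprM w m') rmorphXn /=.
  by rewrite -exprMn.
have zN : z ^+ N = 1.
  by rewrite exprMn -rmorphXn /= -!exprM mulnC (mulnC m') !exprM w1 !expr1n rmorph1 mul1r.
have [mm'|mm'] := eqVneq m m'.
  have -> : z = 1 by rewrite /z -mm' (unity_root_conj N0) // -exprM mulnC exprM w1 expr1n.
  under eq_bigr do rewrite expr1n.
  by rewrite sumr_const card_ord muln1.
rewrite muln0; have z1 : z != 1.
  apply: contra mm' => /eqP z1.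
  have : w ^+ m' == w ^+ m.
    rewrite -[X in _ == X]mulr1 -z1 /z mulrA [_ * conjc _]mulrC.
    by rewrite (unity_root_conj N0) ?mul1r // -exprM mulnC exprM w1 expr1n.
  by rewrite (eq_prim_root_expr wN) !modn_small // eq_sym.
apply/eqP; have := subrX1 z N; rewrite zN subrr => /esym/eqP.
by rewrite mulf_eq0 subr_eq0 (negPf z1).
Qed.

(* The reflection through the bisector of [e_s0] and [v] exchanges them. *)
Lemma state_preparation (R : realType) (S : finType) (v : S -> R) (s0 : S) :
  \sum_s v s ^+ 2 = 1 -> 0 <= v s0 ->
  exists f, lin_isom f /\ f (basis_state R s0) = (fun s => (v s)%:C).
Proof.
(* [r] is the norm of [v + e]; it is nonzero because [v s0] is nonnegative. *)
move=> v1 v0; pose e s : R := (s == s0)%:R; pose r := Num.sqrt (2 + 2 * v s0).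
have r2 : r ^+ 2 = 2 + 2 * v s0 by rewrite sqr_sqrtr //; lra.
have r0 : r != 0 by apply: contra_eq_neq r2 => ->; rewrite expr0n /=; lra.
pose u s : R[i] := ((v s + e s) / r)%:C.
have ev : \sum_s v s * e s = v s0.
  rewrite (bigD1 s0) //= big1 => [|s /negPf ss]; rewrite /e.
    by rewrite eqxx mulr1 addr0.
  by rewrite ss mulr0.
have ee : \sum_s e s ^+ 2 = 1.
  rewrite (bigD1 s0) //= big1 => [|s /negPf ss]; rewrite /e.
    by rewrite eqxx expr1n addr0.
  by rewrite ss expr0n.
have u1 : nrm2 u = 1.
  transitivity (r ^- 2 * (\sum_s v s ^+ 2 + 2 * \sum_s v s * e s + \sum_s e s ^+ 2)).
    rewrite mulr_sumr -!big_split mulr_sumr; apply: eq_bigr => s _ /=.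
    by rewrite sqmod_real; field.
  by rewrite v1 ev ee (_ : 1 + _ + 1 = r ^+ 2) ?mulVf ?expf_neq0 // r2; ring.
exists (refl_along u); split.
  by split; [exact: refl_along_linear | exact: refl_along_isometry].
apply: funext => s; rewrite /refl_along ip_conj ip_basis conjc_real /basis_state.
have -> : ((s == s0)%:R : R[i]) = (e s)%:C by rewrite /e rmorph_nat.
rewrite -[2 in LHS](rmorph_nat (real_complex R)) -!rmorphM -rmorphB /=.
congr (_%:C); rewrite {1}/e eqxx.
apply: (mulIf (expf_neq0 2 r0)); rewrite mulrBl r2.
have -> : 2 * ((v s0 + 1) / r) * ((v s + e s) / r) =
    (2 * (v s0 + 1) * (v s + e s)) / r ^+ 2.
  by field.
rewrite r2; have : 2 + 2 * v s0 != 0 by rewrite -r2 expf_neq0.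
by move=> h; field.
Qed.

(** * The control register and its Fourier transform *)

Section ControlRegister.
Variables (R : realType) (d b N : nat) (W : finType).
Local Notation B := (qbasis d b W).
Local Notation S := (qbasis d b (W * 'I_N)%type).

Definition add_ctl (x : B) (m : 'I_N) : S :=
  let: (j, z, w) := x in (j, z, (w, m)).
Definition base (s : S) : B := let: (j, z, (w, m)) := s in (j, z, w).
Definition ctl (s : S) : 'I_N := s.2.2.

Lemma add_ctlK x m : (base (add_ctl x m) = x) * (ctl (add_ctl x m) = m).
Proof. by case: x => [[j z] w]. Qed.

Lemma base_ctlK s : add_ctl (base s) (ctl s) = s.
Proof. by case: s => [[j z] [w m]]. Qed.

Lemma sum_ctl (A : nmodType) (P : pred 'I_N) (G : S -> A) :
  \sum_(s | P (ctl s)) G s = \sum_(m | P m) \sum_x G (add_ctl x m).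
Proof.
rewrite pair_big /= (reindex (fun p : 'I_N * B => add_ctl p.2 p.1)) /=.
  by apply: eq_bigl => -[m x] /=; rewrite add_ctlK andbT.
exists (fun s => (ctl s, base s)) => [[m x] _|s _] /=.
  by rewrite !add_ctlK.
exact: base_ctlK.
Qed.

Definition slice (psi : qstate R S) (m : 'I_N) : qstate R B :=
  fun x => psi (add_ctl x m).

Lemma sliceP (phi psi : qstate R S) :
  (forall m, slice phi m = slice psi m) -> phi = psi.
Proof.
move=> h; apply: funext => s; rewrite -(base_ctlK s).
exact: (congr1 (fun f => f (base s)) (h (ctl s))).
Qed.

Lemma ip_slice (phi psi : qstate R S) :
  ip phi psi = \sum_m ip (slice phi m) (slice psi m).
Proof. by rewrite /ip (sum_ctl xpredT). Qed.

(** Block-diagonal in the control: a controlled operation when [T] depends on its index, an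
    operation ignoring the control when it does not. *)
Definition lift (T : 'I_N -> qstate R B -> qstate R B) (psi : qstate R S)
    : qstate R S :=
  fun s => T (ctl s) (slice psi (ctl s)) (base s).

Lemma slice_lift T psi m : slice (lift T psi) m = T m (slice psi m).
Proof. by apply: funext => x; rewrite /slice /lift !add_ctlK. Qed.

Lemma lift_lin_isom T : (forall m, lin_isom (T m)) -> lin_isom (lift T).
Proof.
move=> isoT; split=> [a phi psi|phi psi].
  apply: sliceP => m; rewrite slice_lift.
  have [lT _] := isoT m; have := lT a (slice phi m) (slice psi m).
  by rewrite /slice => ->; apply: funext => x; rewrite /lift !add_ctlK.
rewrite !ip_slice; apply: eq_bigr => m _; rewrite !slice_lift.
exact: (isoT m).2.
Qed.

Lemma lift_oracle X psi :
  lift (fun=> qapply (oracle R X)) psi = qapply (oracle R X) psi.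
Proof.
apply: sliceP => m; rewrite slice_lift; apply: funext => x.
rewrite /slice /qapply (sum_ctl xpredT) exchange_big /=; apply: eq_bigr => y _.
rewrite (bigD1 m) //= big1 => [|m' mm'].
  rewrite addr0; congr (_ * _); rewrite /oracle; congr (_%:R).
  case: x y => [[j z] w] [[j' z'] w'] /=.
  by rewrite !xpair_eqE eqxx andbT.
rewrite /oracle; case: x y => [[j z] w] [[j' z'] w'] /=.
by rewrite !xpair_eqE (eq_sym m) (negPf mm') !andbF mul0r.
Qed.

Definition dft (w : R[i]) (psi : qstate R S) : qstate R S :=
  fun s => \sum_(m < N)
    (Num.sqrt N%:R)^-1%:C * w ^+ (ctl s * m) * psi (add_ctl (base s) m).

Lemma dft_lin_isom w : N.-primitive_root w -> lin_isom (dft w).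
Proof.
move=> wN; have N0 := prim_order_gt0 wN; split=> [a phi psi|phi psi].
  apply: funext => s; rewrite /dft mulr_sumr -big_split; apply: eq_bigr => m _ /=; ring.
have aa : (Num.sqrt N%:R)^-1%:C ^+ 2 * N%:R = 1 :> R[i].
  rewrite -(rmorph_nat (real_complex R)) -rmorphXn -rmorphM /= exprVn.
  rewrite sqr_sqrtr ?ler0n // mulVf //.
  by rewrite pnatr_eq0 -lt0n.
rewrite /ip !(sum_ctl xpredT) [LHS]exchange_big [RHS]exchange_big /=.
apply: eq_bigr => x _.
set c := (Num.sqrt _)^-1%:C in aa *.
have cc (u v : R[i]) : conjc (c * u * v) = c * conjc u * conjc v.
  by rewrite !rmorphM /=; congr (_ * _ * _); exact: conjc_real.
(* For each fixed [x] the sum over [y] is isolated, so that orthogonality of the characters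
   collapses the double sum to its diagonal. *)
transitivity (\sum_(y < N) \sum_(m < N) \sum_(m' < N)
   (c ^+ 2 * conjc (phi (add_ctl x m)) * psi (add_ctl x m')) *
   (conjc (w ^+ (y * m)) * w ^+ (y * m'))).
  apply: eq_bigr => y _; rewrite /dft !add_ctlK rmorph_sum mulr_suml.
  apply: eq_bigr => m _; rewrite mulr_sumr; apply: eq_bigr => m' _.
  rewrite /= -/c cc; ring.
rewrite exchange_big /=; apply: eq_bigr => m _.
rewrite exchange_big /=.
under eq_bigr => m' _ do rewrite -mulr_sumr prim_root_orthogonal //.
rewrite (bigD1 m) //= big1 => [|m' /negPf mm']; last first.
  by rewrite eq_sym mm' muln0 mulr0.
rewrite addr0 eqxx muln1 -[RHS]mul1r -[X in _ = X * _]aa.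
by rewrite -[RHS]mulrA [N%:R * _]mulrC !mulrA.
Qed.

Lemma slice_dft w psi (y : 'I_N) :
  slice (dft w psi) y =
  (fun x => \sum_(m < N) (Num.sqrt N%:R)^-1%:C * w ^+ (y * m) * slice psi m x).
Proof. by apply: funext => x; rewrite /slice /dft !add_ctlK. Qed.

End ControlRegister.

(** * Circuits with a counted number of queries *)

Section Implementation.
Variables (R : realType) (d b : nat).

Section Sequence.
Variable W : finType.
Local Notation qmap := (qstate R (qbasis d b W) -> qstate R (qbasis d b W)).

Definition interleave (X : object d b) (fs : seq qmap) psi :=
  foldl (fun psi f => f (qapply (oracle R X) psi)) psi fs.

(** The maps are chosen before [X], hence input-independent, and [q] is the exact number of oracle
    calls. *)
Definition implements (q : nat) (T : object d b -> qmap) : Prop :=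
  exists (f0 : qmap) (fs : seq qmap),
    [/\ lin_isom f0, List.Forall (@lin_isom _ _) fs, size fs = q &
        forall X psi, interleave X fs (f0 psi) = T X psi].

Lemma implements_ext q T T' : (forall X psi, T X psi = T' X psi) ->
  implements q T -> implements q T'.
Proof.
by move=> TT [f0 [fs [h0 hs sz e]]]; exists f0, fs; split=> // X psi; rewrite e.
Qed.

Lemma implements_free f : lin_isom f -> implements 0 (fun=> f).
Proof. by move=> isof; exists f, [::]. Qed.

Lemma implements_oracle : implements 1 (fun X => qapply (oracle R X)).
Proof. by exists id, [:: id]; split=> //; do !constructor. Qed.

(** At the seam the last free map of the first circuit and the first free map of the second merge
    into one, so query counts add exactly. *)
Lemma implements_comp p q T U : implements p T -> implements q U ->
  implements (p + q) (fun X => U X \o T X).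
Proof.
move=> [f0 [fs [hf0 hfs szf ef]]] [g0 [gs [hg0 hgs szg eg]]].
elim/last_ind: fs hfs szf ef => [|fs f _] hfs szf ef.
  exists (g0 \o f0), gs; split=> //; first exact: lin_isom_comp.
    by rewrite -szf.
  by move=> X psi; rewrite /= -ef -eg.
move: hfs; rewrite -cats1 => /List.Forall_app [hfs /List.Forall_cons_iff [hf _]].
exists f0, (fs ++ (g0 \o f) :: gs); split=> //.
- apply/List.Forall_app; split=> //; apply/List.Forall_cons => //.
  exact: lin_isom_comp.
- by rewrite -szf -szg size_cat size_rcons /= addSnnS.
- by move=> X psi; rewrite /= -ef -eg /interleave foldl_rcons foldl_cat.
Qed.

Lemma implements_iter q (T : nat -> object d b -> qmap) k :
  (forall i, implements q (T i)) ->
  implements (k * q)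
    (fun X psi => foldl (fun psi i => T i X psi) psi (iota 0 k)).
Proof.
move=> hT; elim: k => [|k IH].
  by rewrite mul0n; apply: implements_free.
rewrite mulSnr; apply: implements_ext (implements_comp IH (hT k)) => X psi.
by rewrite -[k.+1]addn1 iotaD foldl_cat.
Qed.

Lemma qalg_of_implements q T (s0 : qbasis d b W) (out : qbasis d b W -> R) :
  implements q T ->
  exists A : qalg R d b, [/\ qalg_wf A, queries A = q &
    forall X (P : R -> bool), success_prob A X P =
      \sum_(s | P (out s)) sqmod (T X (basis_state R s0) s)].
Proof.
move=> [f0 [fs [[lf0 if0] hfs szf ef]]].
exists (QAlg s0 (op_of f0) [seq op_of f | f <- fs] out); split.
- split=> /=; first exact: unitary_op_of.
  by elim: hfs => [|f gs [_ iso] _ IH] /=; constructor=> //; exact: unitary_op_of.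
- by rewrite /queries /= size_map.
- move=> X P; rewrite /success_prob /final_state /= -ef.
  suff -> : forall psi, foldl (fun psi U => qapply U (qapply (oracle R X) psi))
      psi [seq op_of f | f <- fs] = interleave X fs psi by rewrite qapply_op_of.
  elim: hfs => //= f gs [lf _] _ IH psi.
  by rewrite qapply_op_of // IH.
Qed.
End Sequence.

(** Only the free maps need lifting: by [lift_oracle] the oracle of the extended register already is
    the lifted oracle. *)
Lemma implements_lift (N : nat) (W : finType) q T :
  @implements W q T ->
  @implements (W * 'I_N)%type q (fun X => lift (fun=> T X)).
Proof.
move=> [f0 [fs [hf0 hfs szf ef]]].
exists (lift (fun=> f0)), [seq lift (fun=> f) | f <- fs]; split.
- exact: lift_lin_isom.
- by elim: hfs => [|f gs hf _ IH] /=; constructor=> //; exact: lift_lin_isom.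
- by rewrite size_map.
- move=> X psi; apply: sliceP => m; rewrite slice_lift -ef.
  suff h : forall phi, slice (interleave X [seq lift (fun=> f) | f <- fs] phi) m =
      interleave X fs (slice phi m) by rewrite h slice_lift.
  elim: fs {hfs szf ef} => //= f gs IH phi.
  by rewrite IH slice_lift -lift_oracle slice_lift.
Qed.

End Implementation.

(** * Reversible tracing of a tree path *)

Section TreeTracing.
Variables (R : realType) (n d b h : nat).
Variables (F : 'I_n -> dtree R d b) (j0 : 'I_d).
Hypothesis height_F : forall i, (dt_height (F i) <= h)%N.

(* Cell [k] stores the attribute value read at depth [k]; the spare last cell
   makes [inord] available for every [h]. *)
Definition record := {ffun 'I_h.+1 -> attr_val b}.
Definition work : finType := ('I_n * record * bool)%type.
Local Notation B := (qbasis d b work).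

(** Conditions are evaluated on the recorded values instead of [X], so the current node is known
    without a query. *)
Fixpoint descend (T : dtree R d b) (r : record) (k : nat) : dtree R d b :=
  if k is k'.+1 then
    match descend T r k' with
    | Leaf y => Leaf y
    | Node _ c Tl Tr => if c (r (inord k')) then Tl else Tr
    end
  else T.

(** Below a leaf the circuit still queries, at the dummy attribute [j0], so that all paths cost the
    same. *)
Definition root_attr (T : dtree R d b) : 'I_d :=
  if T is Node j _ _ _ then j else j0.

Definition leaf_label (T : dtree R d b) : R := if T is Leaf y then y else 0.

Lemma eq_descend T (r r' : record) k :
  (forall l, (l < k)%N -> r (inord l) = r' (inord l)) ->
  descend T r k = descend T r' k.
Proof.
elim: k => //= k IH rr; rewrite IH => [|l lk]; last by rewrite rr // ltnW.
by rewrite rr.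
Qed.

(** A transposition carries [j0] to the wanted attribute and is its own inverse, so the same step
    points and resets. *)
Definition point_attr (k : nat) (x : B) : B :=
  let: (j, z, (i, r, c)) := x in
  (tperm j0 (root_attr (descend (F i) r k)) j, z, (i, r, c)).

Definition exchange (k : nat) (x : B) : B :=
  let: (j, z, (i, r, c)) := x in
  (j, r (inord k), (i, [ffun l => if l == inord k then z else r l], c)).

Lemma point_attrK k : involutive (point_attr k).
Proof. by move=> [[j z] [[i r] c]] /=; rewrite tpermK. Qed.

Lemma exchangeK k : involutive (exchange k).
Proof.
move=> [[j z] [[i r] c]] /=; rewrite ffunE eqxx; congr (_, _, (_, _, _)).
by apply/ffunP => l; rewrite !ffunE; case: eqVneq => [->|].
Qed.

Lemma oracle_mapK X : involutive (@oracle_map d b work X).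
Proof.
move=> [[j z] w] /=; congr (_, _, _).
by apply/ffunP => l; rewrite !ffunE addbK.
Qed.

(* The answer to the query is moved into cell [k] rather than xored into it, so
   that clearing the answer register costs no second query. *)
Definition visit X k : B -> B :=
  point_attr k \o exchange k \o oracle_map X \o point_attr k.
Definition unvisit X k : B -> B :=
  point_attr k \o oracle_map X \o exchange k \o point_attr k.

Lemma visitK X k : cancel (visit X k) (unvisit X k).
Proof.
by move=> x; rewrite /visit /unvisit /= point_attrK exchangeK oracle_mapK point_attrK.
Qed.

Lemma unvisitK X k : cancel (unvisit X k) (visit X k).
Proof.
by move=> x; rewrite /visit /unvisit /= point_attrK oracle_mapK exchangeK point_attrK.
Qed.

Fixpoint trace X k : B -> B :=
  if k is k'.+1 then visit X k' \o trace X k' else id.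
Fixpoint untrace X k : B -> B :=
  if k is k'.+1 then untrace X k' \o unvisit X k' else id.

Lemma traceK X k : cancel (trace X k) (untrace X k).
Proof. by elim: k => // k IH x /=; rewrite visitK IH. Qed.

Lemma untraceK X k : cancel (untrace X k) (trace X k).
Proof. by elim: k => // k IH x /=; rewrite IH unvisitK. Qed.

Lemma qapply_oracle W X (psi : qstate R (qbasis d b W)) :
  involutive (@oracle_map d b W X) ->
  qapply (oracle R X) psi = (fun s => psi (oracle_map X s)).
Proof.
move=> omK; apply: funext => s; rewrite /qapply /oracle (bigD1 (oracle_map X s)) //=.
rewrite omK eqxx mul1r big1 ?addr0 // => s' /negPf ss.
by rewrite -(inj_eq (can_inj omK)) omK eq_sym ss mul0r.
Qed.

Let implements_pullback (g : B -> B) : injective g ->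
  implements 0 (fun X (psi : qstate R B) s => psi (g s)).
Proof. by move=> inj_g; apply: implements_free; exact: lin_isom_pullback. Qed.

Let implements_oracle_pullback :
  implements 1 (fun X (psi : qstate R B) s => psi (oracle_map X s)).
Proof.
apply: implements_ext (implements_oracle R d b work) => X psi.
by rewrite qapply_oracle //; exact: oracle_mapK.
Qed.

Let implements_idle : implements 0 (fun X (psi : qstate R B) s => psi s).
Proof. exact: implements_free (@lin_isom_id R B). Qed.

(** Pullbacks compose contravariantly, so the circuit follows the order in which the factors of
    [visit] are written. *)
Lemma implements_visit k : implements 1 (fun X (psi : qstate R B) s => psi (visit X k s)).
Proof.
have hp := implements_pullback (can_inj (point_attrK k)).
have he := implements_pullback (can_inj (exchangeK k)).
exact: (implements_comp (implements_comp hp he)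
         (implements_comp implements_oracle_pullback hp)).
Qed.

Lemma implements_unvisit k :
  implements 1 (fun X (psi : qstate R B) s => psi (unvisit X k s)).
Proof.
have hp := implements_pullback (can_inj (point_attrK k)).
have he := implements_pullback (can_inj (exchangeK k)).
exact: (implements_comp (implements_comp hp implements_oracle_pullback)
         (implements_comp he hp)).
Qed.

Lemma implements_trace k : implements k (fun X (psi : qstate R B) s => psi (trace X k s)).
Proof.
elim: k => [|k IH]; first exact: implements_idle.
exact: (implements_comp (implements_visit k) IH).
Qed.

Lemma implements_untrace k :
  implements k (fun X (psi : qstate R B) s => psi (untrace X k s)).
Proof.
elim: k => [|k IH]; first exact: implements_idle.
have := implements_comp IH (implements_unvisit k); rewrite addn1; exact.
Qed.

Lemma trace_flag X k x : (trace X k x).2.2 = x.2.2.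
Proof.
have vf l y : (visit X l y).2.2 = y.2.2 by case: y => [[j z] [[i r] c]].
by elim: k => //= k IH; rewrite vf.
Qed.

Definition blank : attr_val b := [ffun=> false].
Definition start (i : 'I_n) (c : bool) : B := (j0, blank, (i, [ffun=> blank], c)).

(** An invariant whose clauses feed the next visit: a blank answer register turns the xor into a
    copy, a blank cell makes the exchange clean that register, and the height bound forces a leaf at
    depth [h]. *)
Lemma trace_prefix X i c k : (k <= h)%N -> exists r : record, [/\
  trace X k (start i c) = (j0, blank, (i, r, c)),
  forall l, (k <= l <= h)%N -> r (inord l) = blank,
  dt_eval X (descend (F i) r k) = dt_eval X (F i) &
  (dt_height (descend (F i) r k) <= h - k)%N].
Proof.
elim: k => [|k IH] kh.
  by exists [ffun=> blank]; split=> //= [l _|]; rewrite ?ffunE // subn0.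
have [r [tr rb ev hgt]] := IH (ltnW kh).
pose j := root_attr (descend (F i) r k).
pose r' : record := [ffun l => if l == inord k then X j else r l].
have inordE l l' : (l <= h)%N -> (l' <= h)%N ->
    (inord l == inord l' :> 'I_h.+1) = (l == l').
  by move=> lh lh'; rewrite -val_eqE /= !inordK.
(* Writing cell [k] does not alter the path down to depth [k], so the second [point_attr] undoes the
   first. *)
have dr : descend (F i) r' k = descend (F i) r k.
  apply: eq_descend => l lk; rewrite ffunE inordE ?(ltn_eqF lk) //.
    by rewrite (leq_trans (ltnW lk)) // ltnW.
  exact: ltnW.
exists r'; split.
- rewrite [LHS]/(visit X k (trace X k (start i c))) tr.
  rewrite /visit /= tpermL rb ?leqnn; last by rewrite ltnW.
  have -> : [ffun l => blank l (+) X j l] = X j.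
    by apply/ffunP => l; rewrite !ffunE.
  by rewrite -/r' dr tpermR.
- move=> l /andP [kl lh]; rewrite ffunE inordE ?(gtn_eqF kl) //; last exact: ltnW.
  by rewrite rb // (ltnW kl).
- rewrite /= -ev dr ffunE eqxx /j.
  by case: (descend (F i) r k) => //= j1 c1 Tl Tr; case: ifP.
- rewrite /= dr ffunE eqxx /j; move: hgt.
  case: (descend (F i) r k) => //= j1 c1 Tl Tr.
  rewrite subnS -[(_ < _)%N]ltnS -{1}[(h - k)%N]prednK ?subn_gt0 // !ltnS.
  by rewrite geq_max; case: ifP => _ /andP [].
Qed.

Lemma trace_start X i c : exists r : record,
  trace X h (start i c) = (j0, blank, (i, r, c)) /\
  leaf_label (descend (F i) r h) = dt_eval X (F i).
Proof.
have [r [-> _ ev hgt]] := trace_prefix X i c (leqnn h).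
exists r; split=> //; rewrite -ev; move: hgt; rewrite subnn.
by case: (descend _ _ _).
Qed.

End TreeTracing.

(** * The spectral gap inequality for the walk *)

Section Walk.
Variables (R : realType) (S : finType) (W W' : qstate R S -> qstate R S).
Variables (u : qstate R S) (c : R).
Hypotheses (isoW : lin_isom W) (isoW' : lin_isom W').
Hypotheses (WK : cancel W W') (W'K : cancel W' W).
Hypothesis walk_start : forall s, W u s + W' u s = (2 * c)%:C * u s.

(** [W] commutes with [W + W^-1], so the relation at [u] propagates along the orbit; no eigenvectors
    are needed. *)
Lemma walk_iter m s :
  W (iter m W u) s + W' (iter m W u) s = (2 * c)%:C * iter m W u s.
Proof.
elim: m s => [|m IH] s /=; first exact: walk_start.
set x := iter m W u in IH *; rewrite WK -[x in LHS]W'K.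
have lW := isoW.1; have := lW 1 (W x) (W' x).
have -> : (fun s' => 1 * W x s' + W' x s') = (fun s' => (2 * c)%:C * x s').
  by apply: funext => s'; rewrite mul1r IH.
rewrite qlinearZ // => /(congr1 (fun f => f s)) /= ->.
by rewrite mul1r W'K.
Qed.

Variable N : nat.
Implicit Types (z : R[i]) (p : {poly R}).

(* [p(z W) u], for [p] of degree less than [N]. *)
Definition filtered z p : qstate R S :=
  fun s => \sum_(m < N) (p`_m)%:C * z ^+ m * iter m W u s.

Lemma filtered_rec z p s :
  W (filtered z p) s + W' (filtered z p) s = (2 * c)%:C * filtered z p s.
Proof.
rewrite !qlinear_sum; [|exact: isoW'.1|exact: isoW.1].
rewrite -big_split mulr_sumr; apply: eq_bigr => m _ /=.
by rewrite -mulrDr walk_iter mulrCA.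
Qed.

(** Multiplication by [X] shifts coefficients, which is the action of [z W]; the strict size bound
    keeps the shifted top coefficient among the [N] retained ones. *)
Lemma filtered_mul z p : (size p < N)%N ->
  filtered z (p * (1 - 'X)) =
  (fun s => filtered z p s - z * W (filtered z p) s).
Proof.
move=> szp; apply: funext => s; rewrite {3}/filtered qlinear_sum; last exact: isoW.1.
rewrite mulrBr mulr1.
have -> : filtered z (p - p * 'X) s =
    filtered z p s - filtered z (p * 'X) s.
  rewrite /filtered -sumrB; apply: eq_bigr => m _.
  by rewrite coefB rmorphB /= !mulrBl.
congr (_ - _); rewrite /filtered; case: N szp => [|N'] szp //.
rewrite big_ord_recl [in RHS]big_ord_recr /= coefMX eqxx !mul0r add0r.
rewrite [p`_N']nth_default // !mul0r addr0 mulr_sumr.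
by apply: eq_bigr => m _; rewrite coefMX /= exprS mulrCA !mulrA.
Qed.

(* With [v := p(zW)u], [(1 - z W^-1) (1 - z W) v = 2 z (Re z - c) v]
   and [1 - z W^-1] has norm at most 2. *)
Lemma filtered_gap z p : conjc z * z = 1 -> (size p < N)%N ->
  (complex.Re z - c) ^+ 2 * nrm2 (filtered z p) <=
  nrm2 (filtered z (p * (1 - 'X))).
Proof.
move=> z1 szp; rewrite filtered_mul //; set v := filtered z p.
set v1 : qstate R S := fun s => _.
have sz1 : sqmod z = 1 by apply: complexI; rewrite sqmodE.
have e : (fun s => v1 s - z * W' v1 s) =
    (fun s => (z * (2 * (complex.Re z - c))%:C) * v s).
  have -> : W' v1 = (fun s => - z * v s + W' v s).
    have := isoW'.1 (- z) (W v) v; rewrite WK => <-.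
    by congr W'; apply: funext => s; rewrite /v1; ring.
  apply: funext => s; have := filtered_rec z p s; rewrite -/v => rec.
  have Rz : (2 * complex.Re z)%:C = z + conjc z by rewrite addcJ rmorphM rmorph_nat.
  rewrite mulrBr rmorphB /= Rz.
  have -> : z * (z + conjc z - (2 * c)%:C) * v s =
    (z ^+ 2 + conjc z * z) * v s - z * ((2 * c)%:C * v s) by ring.
  by rewrite z1 -rec /v1; ring.
have := nrm2B_le v1 (fun s => z * W' v1 s).
rewrite e !nrm2Z sqmodM sz1 mul1r sqmod_real (isometry_nrm2 _ isoW'.2); lra.
Qed.

(** Each factor [1 - X] gains one squared gap and may raise the size by one, hence the room of [k]
    in the size bound. *)
Lemma filtered_gapX z p k : conjc z * z = 1 -> (size p + k <= N)%N ->
  (complex.Re z - c) ^+ (2 * k) * nrm2 (filtered z p) <=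
  nrm2 (filtered z (p * (1 - 'X) ^+ k)).
Proof.
move=> z1; elim: k p => [|k IH] p szp; first by rewrite muln0 !expr0 mul1r mulr1.
have sz1 : size (1 - 'X : {poly R}) = 2%N by rewrite -opprB size_polyN size_XsubC.
have szp1 : (size (p * (1 - 'X))%R <= (size p).+1)%N.
  by rewrite (leq_trans (size_polyMleq _ _)) // sz1 addn2.
rewrite mulnS exprD -mulrA mulrCA [in leRHS]exprS [in leRHS]mulrA.
have szk : (size (p * (1 - 'X))%R + k <= N)%N.
  by rewrite (leq_trans _ szp) // -addSnnS leq_add2r.
apply: le_trans (IH _ szk).
apply: ler_wpM2l; first by rewrite exprM exprn_ge0 ?sqr_ge0.
apply: filtered_gap => //.
by rewrite (leq_trans _ szp) // addnS ltnS leq_addr.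
Qed.
End Walk.

(** Since [P u = u], the second term is [Q u], which cancels against the [- Q u] in [P Q u]. *)
Lemma reflection_walk_start (R : realType) (S : finType) (u : qstate R S)
    (Q : qstate R S -> qstate R S) (c : R) (s : S) :
  nrm2 u = 1 -> ip u (Q u) = c%:C ->
  refl_along u (Q u) s + Q (refl_along u u) s = (2 * c)%:C * u s.
Proof.
move=> u1 uQ; have -> : refl_along u u = u.
  by apply: funext => t; rewrite /refl_along ip_nrm2 u1; ring.
by rewrite /refl_along uQ rmorphM rmorph_nat; ring.
Qed.

(** * Smooth windows as polynomials *)

Section Window.
Variables (R : realType).
Implicit Types p q : {poly R}.

Definition l2 N p : R := \sum_(m < N) p`_m ^+ 2.

(** A shift can only push coefficients past the truncation at [N]; then
    [(x - y)^2 <= 2 x^2 + 2 y^2]. *)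
Lemma l2_mul1BXn N t p : l2 N (p * (1 - 'X^t)) <= 4 * l2 N p.
Proof.
have shift : l2 N (p * 'X^t) <= l2 N p.
  rewrite /l2; have [tN|Nt] := leqP t N; last first.
    rewrite big1 => [|m _]; first by apply: sumr_ge0 => ? _; exact: sqr_ge0.
    by rewrite coefMXn (ltn_trans (ltn_ord m) Nt) expr0n.
  rewrite -!(big_mkord xpredT (fun m => _`_m ^+ 2)) (big_cat_nat (n := t)) //=.
  rewrite big_nat big1 => [|m /andP [_ mt]]; last by rewrite coefMXn mt expr0n.
  rewrite add0r -{1}[t]add0n big_addn.
  rewrite [leRHS](big_cat_nat (n := N - t)) ?leq_subr //=.
  rewrite -[leLHS]addr0 lerD ?sumr_ge0 // => [|? _]; last exact: sqr_ge0.
  by apply: ler_sum => m _; rewrite coefMXn ltnNge leq_addl /= addnK.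
have -> : 4 * l2 N p = 2 * l2 N p + 2 * l2 N p by ring.
apply: le_trans (lerD (lexx _) (ler_wpM2l _ shift)) => //.
rewrite /l2 !mulr_sumr -big_split; apply: ler_sum => m _ /=.
rewrite mulrBr mulr1 coefB -subr_ge0.
set x := p`_m; set y := (p * 'X^t)`_m.
by rewrite (_ : _ - _ = (x + y) ^+ 2) ?sqr_ge0 //; ring.
Qed.

Lemma l2_mul1BXnX N t k p : l2 N (p * (1 - 'X^t) ^+ k) <= 4 ^+ k * l2 N p.
Proof.
elim: k p => [|k IH] p; first by rewrite !expr0 mulr1 mul1r.
rewrite [in leLHS]exprS mulrA (le_trans (IH _)) // exprSr -mulrA.
by rewrite ler_wpM2l ?exprn_ge0 // l2_mul1BXn.
Qed.

(** Cauchy-Schwarz against the all-ones vector, proved through the variance of the coefficients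
    around their mean [mu]. *)
Lemma sqr_horner1_le N p : (size p <= N)%N -> p.[1] ^+ 2 <= N%:R * l2 N p.
Proof.
case: N => [|N] szp.
  by move: szp; rewrite leqn0 size_poly_eq0 => /eqP ->; rewrite horner0 mul0r expr0n.
rewrite (horner_coef_wide _ szp); under eq_bigr do rewrite expr1n mulr1.
set s1 := \sum_(m < _) _; pose mu := s1 / N.+1%:R.
have N0 : (N.+1%:R : R) != 0 by rewrite pnatr_eq0.
have : 0 <= \sum_(m < N.+1) (p`_m - mu) ^+ 2 by apply: sumr_ge0 => ? _; exact: sqr_ge0.
have -> : \sum_(m < N.+1) (p`_m - mu) ^+ 2 = l2 N.+1 p - 2 * mu * s1 + N.+1%:R * mu ^+ 2.
  have -> : N.+1%:R * mu ^+ 2 = \sum_(m < N.+1) mu ^+ 2.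
    by rewrite sumr_const card_ord mulr_natl.
  rewrite /l2 /s1 mulr_sumr -sumrB -big_split; apply: eq_bigr => m _ /=; ring.
rewrite -(pmulr_rge0 _ (ltr0Sn R N)) -[_ <= _ * l2 _ _]subr_ge0.
rewrite (_ : _ * (_ - _ + _) = N.+1%:R * l2 N.+1 p - s1 ^+ 2) //.
by rewrite /mu; move: (N.+1%:R : R) N0 => n' n'0; field.
Qed.

(* The [k+1]-fold convolution of a box of length [t]. *)
Definition window (t k : nat) : {poly R} := (\sum_(i < t) 'X^i) ^+ k.+1.

(** The degree is at most [(k+1)(t-1)], which leaves room below [(k+1)t] for [k] more factors
    [1 - X]. *)
Lemma size_window t k : (0 < t)%N -> (size (window t k) + k <= k.+1 * t)%N.
Proof.
move=> t0; rewrite /window.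
have szg : (size (\sum_(i < t) 'X^i : {poly R})%R <= t)%N.
  apply: (leq_trans (size_sum _ _ _)); apply/bigmax_leqP => i _.
  by rewrite size_polyXn.
move: szg; move: (\sum_(i < t) 'X^i) => g szg.
have := size_poly_exp_leq g k.+1.
have : ((size g).-1 * k.+1 <= t.-1 * k.+1)%N by rewrite leq_mul2r -!subn1 leq_sub2r.
case: t t0 {szg} => // t _ /=; nia.
Qed.

(** Makes the window nonzero, hence normalisable, and gives the nonnegative amplitude at [s0] that
    state preparation requires. *)
Lemma window0 t k : (0 < t)%N -> (window t k)`_0 = 1.
Proof.
case: t => // t _; rewrite -horner_coef0 /window horner_exp horner_sum.
rewrite big_ord_recl big1 => [|i _]; first by rewrite hornerXn expr0 addr0 expr1n.
by rewrite hornerXn expr0n.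
Qed.

(** Of the [k+1] boxes, [k] telescope with [(1 - X)^k] into [(1 - X^t)^k], leaving one box of
    squared norm [t]. The norm of the window is bounded below by its value [t^(k+1)] at 1. *)
Lemma window_smooth t k (N := (k.+1 * t)%N) : (0 < t)%N ->
  l2 N (window t k * (1 - 'X) ^+ k) * t%:R ^+ (2 * k) <=
  k.+1%:R * 4 ^+ k * l2 N (window t k).
Proof.
move=> t0; set g : {poly R} := \sum_(i < t) 'X^i.
have diff : window t k * (1 - 'X) ^+ k = g * (1 - 'X^t) ^+ k.
  rewrite /window -/g exprS -mulrA -exprMn; congr (_ * _ ^+ _).
  by rewrite -[1 - 'X]opprB mulrN mulrC -subrX1 opprB.
have l2g : l2 N g = t%:R.
  have tN : (t <= N)%N by rewrite leq_pmull.
  transitivity (\sum_(m < t) 1 : R); last by rewrite sumr_const card_ord.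
  rewrite (big_ord_widen N (fun=> 1)) // /l2 [RHS]big_mkcond /=; apply: eq_bigr => m _.
  rewrite /g coef_sum; case: ltnP => mt.
    rewrite (bigD1 (Ordinal mt)) //= coefXn eqxx big1 ?addr0 ?expr1n // => i im.
    by rewrite coefXn eq_sym; move: im; rewrite -val_eqE /= => /negPf ->.
  rewrite big1 ?expr0n // => i _.
  by rewrite coefXn gtn_eqF // (leq_trans _ mt).
have numer := l2_mul1BXnX N t k g; rewrite l2g in numer.
have := sqr_horner1_le (leq_trans (leq_addr _ _) (size_window k t0)).
have -> : (window t k).[1] = t%:R ^+ k.+1.
  rewrite horner_exp horner_sum; congr (_ ^+ _).
  under eq_bigr do rewrite hornerXn expr1n.
  by rewrite sumr_const card_ord.
rewrite -/N => denom; rewrite diff.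
have t1 : 0 < t%:R :> R by rewrite ltr0n.
have bound : t%:R * t%:R ^+ (2 * k) <= k.+1%:R * l2 N (window t k).
  rewrite -(ler_pM2l t1) [leRHS]mulrA -natrM (mulnC t) -!exprS.
  by rewrite (_ : (2 * k).+2 = (k.+1 * 2)%N) ?exprM //; lia.
apply: le_trans (ler_wpM2r _ numer) _; first by rewrite exprn_ge0 ?ler0n.
by rewrite -[leLHS]mulrA -[leRHS]mulrA [leRHS]mulrCA ler_wpM2l ?exprn_ge0.
Qed.

End Window.

(** * The reflection of the flag qubit *)

Section FlagReflection.
Variables (R : realType) (n d b h : nat).
Variables (F : 'I_n -> dtree R d b) (g : R -> R).
Hypothesis g_le1 : forall y, g y ^+ 2 <= 1.
Local Notation B := (qbasis d b (work n b h)).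
Implicit Types (x : B) (phi psi : qstate R B).

Definition node_cos x : R :=
  let: (_, _, (i, r, _)) := x in g (leaf_label (descend (F i) r h)).
Definition node_sin x : R := Num.sqrt (1 - node_cos x ^+ 2).
Definition flip_flag x : B := let: (j, z, (i, r, c)) := x in (j, z, (i, r, ~~ c)).

Definition flag_refl psi : qstate R B := fun x =>
  ((-1) ^+ x.2.2 * node_cos x)%:C * psi x + (node_sin x)%:C * psi (flip_flag x).

Lemma flip_flagK : involutive flip_flag.
Proof. by move=> [[j z] [[i r] c]] /=; rewrite negbK. Qed.

Lemma node_cos_flip x : node_cos (flip_flag x) = node_cos x.
Proof. by case: x => [[j z] [[i r] c]]. Qed.

Lemma node_sin_flip x : node_sin (flip_flag x) = node_sin x.
Proof. by rewrite /node_sin node_cos_flip. Qed.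

Lemma node_cos_sin x : node_cos x ^+ 2 + node_sin x ^+ 2 = 1.
Proof.
rewrite sqr_sqrtr; first by rewrite addrC subrK.
by case: x => [[j z] [[i r] c]] /=; rewrite subr_ge0.
Qed.

Lemma flag_reflK : involutive flag_refl.
Proof.
move=> psi; apply: funext => x; rewrite /flag_refl node_cos_flip node_sin_flip flip_flagK.
have -> : (-1) ^+ (flip_flag x).2.2 = - (-1) ^+ x.2.2 :> R.
  by case: x => [[j z] [[i r] []]] /=; rewrite ?opprK.
rewrite mulNr rmorphN.
have sgn2 : ((-1) ^+ x.2.2 * node_cos x)%:C ^+ 2 + (node_sin x)%:C ^+ 2 = 1 :> R[i].
  by rewrite -!rmorphXn -rmorphD /= exprMn sqrr_sign mul1r node_cos_sin.
by rewrite -[RHS]mul1r -[X in _ = X * _]sgn2; ring.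
Qed.

(** Self-adjointness and involutivity together give the isometry property. *)
Lemma flag_refl_adjoint phi psi : ip (flag_refl phi) psi = ip phi (flag_refl psi).
Proof.
transitivity (\sum_x conjc (phi x) * (((-1) ^+ x.2.2 * node_cos x)%:C * psi x) +
    \sum_x conjc (phi (flip_flag x)) * ((node_sin x)%:C * psi x)).
  rewrite -big_split; apply: eq_bigr => x _ /=.
  have cr (a a' : R) (u v : R[i]) :
      conjc (a%:C * u + a'%:C * v) = a%:C * conjc u + a'%:C * conjc v.
    by case: u v => [? ?] [? ?]; simpc; rewrite /=; congr (_ +i* _); ring.
  by rewrite cr; ring.
rewrite [X in _ + X](reindex_inj (can_inj flip_flagK)) /=.
rewrite -big_split; apply: eq_bigr => x _ /=.
by rewrite flip_flagK node_sin_flip -mulrDr.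
Qed.

Lemma flag_refl_lin_isom : lin_isom flag_refl.
Proof.
split=> [a phi psi|phi psi]; last by rewrite flag_refl_adjoint flag_reflK.
by apply: funext => x; rewrite /flag_refl; ring.
Qed.

End FlagReflection.

(** * The estimation circuit and its error probability *)

Section Estimation.
Variables (R : realType) (n d b h : nat).
Variables (F : 'I_n -> dtree R d b) (g : R -> R) (j0 : 'I_d).
Hypotheses (n_gt0 : (0 < n)%N) (height_F : forall i, (dt_height (F i) <= h)%N).
Hypothesis g_le1 : forall y, g y ^+ 2 <= 1.
Local Notation B := (qbasis d b (work n b h)).

Let start i c : B := start b h j0 i c.

(** Here [x.2.1.1] is the tree index, so the test selects the clean configuration of that tree.
    Amplitudes are real, as [state_preparation] expects. *)
Definition uniform_amp (x : B) : R :=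
  if x == start x.2.1.1 false then (Num.sqrt n%:R)^-1 else 0.
Definition uniform : qstate R B := fun x => (uniform_amp x)%:C.

Lemma sum_start (A : nmodType) (G : B -> A) :
  \sum_(x | x == start x.2.1.1 false) G x = \sum_i G (start i false).
Proof.
rewrite (reindex_onto (start ^~ false) (fun x : B => x.2.1.1)) /=.
  by apply: eq_bigl => i; rewrite !eqxx.
by move=> x /eqP.
Qed.

Lemma uniform_start i : uniform_amp (start i false) = (Num.sqrt n%:R)^-1.
Proof. by rewrite /uniform_amp eqxx. Qed.

Lemma sqrt_natV (m : nat) : (Num.sqrt m%:R)^-1 ^+ 2 = m%:R^-1 :> R.
Proof. by rewrite exprVn sqr_sqrtr. Qed.

Lemma sum_uniform_amp : \sum_x uniform_amp x ^+ 2 = 1.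
Proof.
transitivity (\sum_(x | x == start x.2.1.1 false) uniform_amp x ^+ 2).
  rewrite [RHS]big_mkcond; apply: eq_bigr => x _; rewrite /uniform_amp.
  by case: ifP => // _; rewrite expr0n.
rewrite sum_start; under eq_bigr do rewrite uniform_start sqrt_natV //.
by rewrite sumr_const card_ord -[_ *+ n]mulr_natl mulfV // pnatr_eq0 -lt0n.
Qed.

Lemma nrm2_uniform : nrm2 uniform = 1.
Proof. by rewrite -sum_uniform_amp; apply: eq_bigr => x _; rewrite sqmod_real. Qed.

(** Pulling back along [untrace] sends basis state [x] to [trace x], so this traces, reflects the
    flag, then untraces. *)
Definition tree_refl X (psi : qstate R B) : qstate R B :=
  fun x => flag_refl F g (fun y => psi (untrace F j0 X h y)) (trace F j0 X h x).

Definition mean (X : object d b) : R := n%:R^-1 * \sum_i g (dt_eval X (F i)).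

Lemma tree_reflK X : involutive (tree_refl X).
Proof.
move=> psi; apply: funext => x; rewrite /tree_refl.
have -> : (fun y => flag_refl F g (fun y0 => psi (untrace F j0 X h y0))
     (trace F j0 X h (untrace F j0 X h y))) =
   flag_refl F g (fun y0 => psi (untrace F j0 X h y0)).
  by apply: funext => y; rewrite untraceK.
by rewrite flag_reflK // traceK.
Qed.

Lemma tree_refl_lin_isom X : lin_isom (tree_refl X).
Proof.
have hV := lin_isom_pullback R (can_inj (untraceK F j0 X h)).
have hV' := lin_isom_pullback R (can_inj (traceK F j0 X h)).
have hD := @flag_refl_lin_isom R n d b h F g g_le1.
exact: (lin_isom_comp (hV' h) (lin_isom_comp hD (hV h))).
Qed.

Lemma uniform_tree_refl X : ip uniform (tree_refl X uniform) = (mean X)%:C.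
Proof.
transitivity (\sum_(x | x == start x.2.1.1 false)
   (Num.sqrt n%:R)^-1%:C * tree_refl X uniform x).
  rewrite [RHS]big_mkcond; apply: eq_bigr => x _; rewrite conjc_real /uniform_amp.
  by case: ifP => // _; rewrite mul0r.
rewrite sum_start /mean mulr_sumr rmorph_sum; apply: eq_bigr => i _ /=.
have [r [tr lab]] := trace_start j0 height_F X i false.
rewrite /tree_refl /start tr /flag_refl /= -tr traceK.
(* The flipped configuration keeps its raised flag when untraced, so it lies outside the support of
   [uniform]; only the diagonal entry of the reflection survives. *)
have -> : uniform (untrace F j0 X h (j0, blank b, (i, r, true))) = 0.
  set y := untrace _ _ _ _ _; rewrite /uniform /uniform_amp ifF //.
  apply: contraTF isT => /eqP ey.
  have := trace_flag F j0 X h y; rewrite untraceK /=.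
  by rewrite ey.
rewrite mulr0 addr0 mul1r lab -rmorphM -rmorphM; congr (_%:C).
by rewrite uniform_start mulrCA -expr2 sqrt_natV // mulrC.
Qed.

Variables (t k : nat).
Hypothesis t_gt0 : (0 < t)%N.
Let N := (k.+1 * t)%N.

Definition walk X : qstate R B -> qstate R B := refl_along uniform \o tree_refl X.
Definition walk' X : qstate R B -> qstate R B := tree_refl X \o refl_along uniform.

Lemma refl_uniform : lin_isom (refl_along uniform).
Proof.
split; [exact: refl_along_linear | exact: refl_along_isometry nrm2_uniform].
Qed.

Lemma walk_lin_isom X : lin_isom (walk X).
Proof. exact: lin_isom_comp refl_uniform (tree_refl_lin_isom X). Qed.

Lemma walk'_lin_isom X : lin_isom (walk' X).
Proof. exact: lin_isom_comp (tree_refl_lin_isom X) refl_uniform. Qed.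

Lemma walkK X : cancel (walk X) (walk' X).
Proof. by move=> psi; rewrite /walk /walk' /= refl_alongK ?nrm2_uniform // tree_reflK. Qed.

Lemma walk'K X : cancel (walk' X) (walk X).
Proof. by move=> psi; rewrite /walk /walk' /= tree_reflK refl_alongK ?nrm2_uniform. Qed.

Lemma walk_uniform X x :
  walk X uniform x + walk' X uniform x = (2 * mean X)%:C * uniform x.
Proof. exact: reflection_walk_start nrm2_uniform (uniform_tree_refl X). Qed.

Lemma walk_iter_lin_isom X m : lin_isom (iter m (walk X)).
Proof.
elim: m => [|m IH]; first exact: lin_isom_id.
exact: lin_isom_comp (walk_lin_isom X) IH.
Qed.

(** Running these for all [i < N.-1] applies exactly [m] walk steps at control value [m]. *)
Definition ctl_walk i X : qstate R (qbasis d b (work n b h * 'I_N)%type) -> _ :=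
  lift (fun m : 'I_N => if (i < m)%N then walk X else id).

(** Only the two query-free reflections are controlled; with the control off, tracing and untracing
    cancel. *)
Lemma implements_ctl_walk i : implements (h + h) (ctl_walk i).
Proof.
pose D := lift (fun m : 'I_N => if (i < m)%N then flag_refl F g else id) :
  qstate R (qbasis d b (work n b h * 'I_N)%type) -> _.
pose P := lift (fun m : 'I_N => if (i < m)%N then refl_along uniform else id) :
  qstate R (qbasis d b (work n b h * 'I_N)%type) -> _.
have hD : implements 0 (fun _ => D).
  apply: implements_free; apply: lift_lin_isom => m; case: ifP => // _.
  exact: flag_refl_lin_isom.
have hP : implements 0 (fun _ => P).
  apply: implements_free; apply: lift_lin_isom => m; case: ifP => // _.
  exact: refl_uniform.
have := implements_comp
  (implements_comp (implements_lift N (implements_untrace h F j0 h)) hD)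
  (implements_comp (implements_lift N (implements_trace h F j0 h)) hP).
rewrite !addn0; apply: implements_ext => X psi.
apply: sliceP => m; rewrite /ctl_walk /= !slice_lift.
case: ifP => // _; apply: funext => x /=.
by rewrite traceK.
Qed.

Lemma slice_ctl_walks X psi l (m : 'I_N) :
  slice (foldl (fun psi i => ctl_walk i X psi) psi (iota 0 l)) m =
  iter (minn l m) (walk X) (slice psi m).
Proof.
elim: l => [|l IH]; first by rewrite min0n.
rewrite -[l.+1]addn1 iotaD foldl_cat /= slice_lift IH addn1 add0n.
case: ltnP => lm; last by rewrite (minn_idPr (leqW lm)).
by rewrite (minn_idPl lm).
Qed.

(** [dft] preserves the norm of the state with slices [p_m W^m u]; the factor [N] undoes its
    normalisation. *)
Lemma filtered_parseval X w (p : {poly R}) : N.-primitive_root w ->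
  \sum_(y < N) nrm2 (filtered (walk X) uniform N (w ^+ y) p) = N%:R * l2 N p.
Proof.
move=> wN; have N0 := prim_order_gt0 wN.
pose psi : qstate R (qbasis d b (work n b h * 'I_N)%type) :=
  fun s => (p`_(ctl s))%:C * iter (ctl s) (walk X) uniform (base s).
have slpsi m : slice psi m = (fun x => (p`_m)%:C * iter m (walk X) uniform x).
  by apply: funext => x; rewrite /slice /psi !add_ctlK.
have nrm_slice (phi : qstate R (qbasis d b (work n b h * 'I_N)%type)) :
    nrm2 phi = \sum_m nrm2 (slice phi m).
  by rewrite /nrm2 (sum_ctl xpredT).
have := isometry_nrm2 psi (dft_lin_isom d b (work n b h) wN).2.
rewrite !nrm_slice.
have -> : \sum_(m < N) nrm2 (slice psi m) = l2 N p.
  apply: eq_bigr => m _; rewrite slpsi nrm2Z sqmod_real.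
  by rewrite (isometry_nrm2 _ (walk_iter_lin_isom X m).2) nrm2_uniform mulr1.
move=> <-; rewrite mulr_sumr; apply: eq_bigr => y _.
rewrite slice_dft.
have -> : (fun x => \sum_(m < N) (Num.sqrt N%:R)^-1%:C * w ^+ (y * m) * slice psi m x) =
   (fun x => (Num.sqrt N%:R)^-1%:C * filtered (walk X) uniform N (w ^+ y) p x).
  apply: funext => x; rewrite mulr_sumr; apply: eq_bigr => m _.
  by rewrite slpsi exprM -!mulrA; congr (_ * _); rewrite mulrCA.
rewrite nrm2Z sqmod_real sqrt_natV // mulrA mulfV ?mul1r //.
by rewrite pnatr_eq0 -lt0n.
Qed.

Lemma mean_estimation (post : R -> R) : exists A : qalg R d b,
  [/\ qalg_wf A, queries A = (N.-1 * (h + h))%N &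
    forall X (P : R -> bool),
      (forall o, `|o - mean X| <= 8 / t%:R -> P (post o)) ->
      1 - k.+1%:R / 16 ^+ k <= success_prob A X P].
Proof.
have N0 : (0 < N)%N by rewrite muln_gt0.
have [w wN] := complex_prim_root_exists R N0.
pose p := window R t k; pose L := l2 N p.
have p0 : p`_0 = 1 by exact: window0.
have L0 : 0 < L.
  rewrite /L /l2 (bigD1 (Ordinal N0)) //= p0 expr1n ltr_wpDr //.
  by apply: sumr_ge0 => ? _; exact: sqr_ge0.
pose v (s : qbasis d b (work n b h * 'I_N)%type) : R :=
  p`_(ctl s) / Num.sqrt L * uniform_amp (base s).
pose s0 := add_ctl (start (Ordinal n_gt0) false) (Ordinal N0).
have v1 : \sum_s v s ^+ 2 = 1.
  rewrite (sum_ctl xpredT) /=.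
  transitivity (\sum_(m < N) p`_m ^+ 2 / L); last first.
    by rewrite -mulr_suml mulfV // gt_eqF.
  apply: eq_bigr => m _; rewrite -[RHS]mulr1 -sum_uniform_amp mulr_sumr.
  apply: eq_bigr => x _; rewrite /v !add_ctlK !exprMn exprVn sqr_sqrtr //.
  exact: ltW.
have v0 : 0 <= v s0.
  rewrite /v /s0 !add_ctlK uniform_start p0 mul1r mulr_ge0 ?invr_ge0 ?sqrtr_ge0 //.
have [prep [prep_iso prepE]] := state_preparation v1 v0.
have impl := implements_comp
  (implements_comp (implements_free prep_iso)
     (implements_iter N.-1 implements_ctl_walk))
  (implements_free (dft_lin_isom d b (work n b h) wN)).
have [A [wfA qA sA]] :=
  qalg_of_implements s0 (fun s => post (complex.Re (w ^+ ctl s))) impl.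
exists A; split=> // [|X P okP]; first by rewrite qA add0n addn0.
rewrite sA /= prepE (sum_ctl (fun y : 'I_N => P (post (complex.Re (w ^+ y))))).
set psi := dft _ _.
pose E y := nrm2 (filtered (walk X) uniform N (w ^+ y) p).
have prob_y (y : 'I_N) : \sum_x sqmod (psi (add_ctl x y)) = E y / (N%:R * L).
  transitivity (nrm2 (fun x =>
      ((Num.sqrt N%:R)^-1 / Num.sqrt L)%:C * filtered (walk X) uniform N (w ^+ y) p x)).
    rewrite -[LHS]/(nrm2 (slice psi y)); congr nrm2.
    rewrite slice_dft; apply: funext => x; rewrite mulr_sumr; apply: eq_bigr => m _.
    (* Control values are at most [N.-1], so [N.-1] controlled steps suffice. *)
    rewrite slice_ctl_walks (minn_idPr _); last by rewrite -ltnS prednK.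
    have -> : slice (fun s => (v s)%:C) m = (fun x => (p`_m / Num.sqrt L)%:C * uniform x).
      by apply: funext => x'; rewrite /slice /v !add_ctlK rmorphM.
    rewrite (qlinearZ _ _ (walk_iter_lin_isom X m).1) -exprM !rmorphM; ring.
  rewrite nrm2Z sqmod_real exprMn sqrt_natV // exprVn sqr_sqrtr ?(ltW L0) //.
  by rewrite invfM mulrC.
under eq_bigr do rewrite prob_y.
have total : \sum_(y < N) E y / (N%:R * L) = 1.
  rewrite -mulr_suml filtered_parseval // mulfV // mulf_neq0 ?gt_eqF //.
  by rewrite ltr0n.
rewrite (bigID (fun y : 'I_N => P (post (complex.Re (w ^+ y))))) /= in total.
(* It remains to bound the total probability of the bad outcomes. *)
rewrite -[X in X - _]total lerBlDr lerD2l.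
pose gap (y : 'I_N) := complex.Re (w ^+ y) - mean X.
have t0 : 0 < t%:R :> R by rewrite ltr0n.
(* Markov threshold: the moment bound [(k+1) (4 / t^2)^k] divided by [(8 / t)^(2k)] is
   [(k+1) / 16^k]. *)
have tau0 : 0 < (8 / t%:R) ^+ (2 * k) :> R by rewrite exprn_gt0 ?divr_gt0.
rewrite -(ler_pM2l tau0) mulr_sumr.
pose q := p * (1 - 'X) ^+ k.
have NL0 : 0 < N%:R * L by rewrite mulr_gt0 // ltr0n.
apply: (@le_trans _ _ (\sum_(y < N)
    nrm2 (filtered (walk X) uniform N (w ^+ y) q) / (N%:R * L))).
  rewrite [leRHS](bigID (fun y : 'I_N => P (post (complex.Re (w ^+ y))))) /=.
  rewrite ler_wpDl //.
    by apply: sumr_ge0 => y _; rewrite divr_ge0 ?nrm2_ge0 ?ltW.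
  apply: ler_sum => y bad; rewrite mulrA ler_pM2r ?invr_gt0 //.
  apply: le_trans (filtered_gapX (walk_lin_isom X) (walk'_lin_isom X) (walkK X)
    (walk'K X) (walk_uniform X) (unity_root_conj N0 _) (size_window R k t_gt0)).
    rewrite ler_wpM2r ?nrm2_ge0 // !exprM.
    have far : 8 / t%:R <= `|gap y|.
      by apply: contraNT bad; rewrite -ltNge => /ltW; exact: okP.
    rewrite lerXn2r ?nnegrE ?sqr_ge0 // -[leRHS]real_normK ?num_real //.
    by rewrite lerXn2r ?nnegrE ?normr_ge0 // ltW // divr_gt0.
  by rewrite -exprM mulnC exprM (prim_expr_order wN) expr1n.
rewrite -mulr_suml filtered_parseval // -mulf_div mulfV ?mul1r; last first.
  by rewrite pnatr_eq0 -lt0n.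
rewrite ler_pdivrMr //.
have := window_smooth R k t_gt0; rewrite -/N -/p -/q -/L => smooth.
have t2k : 0 < t%:R ^+ (2 * k) :> R by rewrite exprn_gt0.
rewrite -(ler_pM2r t2k) (le_trans smooth) // le_eqVlt; apply/orP; left; apply/eqP.
have -> : (8 / t%:R) ^+ (2 * k) = 4 ^+ k * 16 ^+ k / t%:R ^+ (2 * k) :> R.
  by rewrite expr_div_n exprM -exprMn; congr (_ ^+ k / _); ring.
by field; rewrite !expf_neq0 ?gt_eqF.
Qed.

End Estimation.

(** * From the mean of the trees to the forest prediction *)

Section Forest.
Variables (R : realType) (n d b h : nat) (F : 'I_n -> dtree R d b).
Hypotheses (n_gt0 : (0 < n)%N) (d_gt0 : (0 < d)%N).
Hypothesis height_F : forall i, (dt_height (F i) <= h)%N.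
Hypothesis ymin_lt : ymin F < ymax F.

Lemma dt_eval_leaves X (T : dtree R d b) : dt_eval X T \in dt_leaves T.
Proof.
elim: T => [y|j c Tl IHl Tr IHr] /=; first by rewrite mem_head.
by rewrite mem_cat; case: ifP => _; rewrite ?IHl ?IHr ?orbT.
Qed.

Lemma dt_eval_bounds X i : ymin F <= dt_eval X (F i) <= ymax F.
Proof.
have leaf : dt_eval X (F i) \in forest_leaves F.
  apply/flattenP; exists (dt_leaves (F i)); last exact: dt_eval_leaves.
  by apply: map_f; rewrite mem_enum.
by rewrite /ymin /ymax ge_bigmin_seq //= le_bigmax_seq.
Qed.

Lemma dt_eval_scaled_bounds X i :
  0 <= (dt_eval X (F i) - ymin F) / (ymax F - ymin F) <= 1.
Proof.
have /andP [lo hi] := dt_eval_bounds X i.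
have D0 : 0 < ymax F - ymin F by rewrite subr_gt0.
by rewrite ler_pdivrMr // mul1r lerD2r hi andbT divr_ge0 ?subr_ge0 // ltW.
Qed.

Lemma rf_beta_bounds X : 0 <= rf_beta F X <= 1.
Proof.
rewrite /rf_beta mulr_ge0 ?invr_ge0 ?sumr_ge0 //= => [|i _]; last first.
  by have /andP [] := dt_eval_scaled_bounds X i.
rewrite mulrC ler_pdivrMr ?ltr0n // mul1r.
apply: (@le_trans _ _ (\sum_(i < n) 1)); last by rewrite sumr_const card_ord.
by apply: ler_sum => i _; have /andP [] := dt_eval_scaled_bounds X i.
Qed.

Lemma rf_predict_beta X :
  rf_predict F X = ymin F + (ymax F - ymin F) * rf_beta F X.
Proof.
have D0 : ymax F - ymin F != 0 by rewrite subr_eq0 gt_eqF.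
have n0 : n%:R != 0 :> R by rewrite pnatr_eq0 -lt0n.
rewrite /rf_predict /rf_beta -mulr_suml sumrB sumr_const card_ord.
rewrite -[ymin F *+ n]mulr_natr.
move: (\sum_i _) (n%:R : R) n0 => s n' n0; field.
by rewrite n0 D0.
Qed.

(** Chooses the window order [k]: of [16^k = 4^k 4^k], one factor absorbs [k+1] and the other
    exceeds [delta^-1], because [e <= 4]. *)
Lemma repetitions (delta : R) : 0 < delta < 1 ->
  exists k, k.+1%:R / 16 ^+ k <= delta /\ k.+1%:R <= 2 * (1 + ln delta^-1).
Proof.
move=> /andP [d0 d1]; set l := ln _.
have l0 : 0 <= l by rewrite ln_ge0 // invf_ge1 // ltW.
pose k := (Num.truncn l).+1; exists k.
have /andP [kl lk] := truncn_itv l0.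
have e4 : expR k%:R <= 4 ^+ k :> R.
  (* From [1 - 1/2 <= exp(-1/2)]; squaring gives [e <= 4]. *)
  have eh : expR (2^-1) <= 2 :> R.
    have := expR_ge1Dx (- 2^-1 : R); rewrite expRN => h1.
    have h2 : 2^-1 <= (expR 2^-1)^-1 :> R by apply: le_trans h1; lra.
    by rewrite -lef_pV2 ?posrE ?expR_gt0.
  rewrite -[k%:R]mulr1 expRM_natl lerXn2r ?nnegrE ?expR_ge0 //.
  have -> : expR 1 = expR 2^-1 ^+ 2 :> R by rewrite -expRM_natl; congr expR; field.
  have -> : 4 = 2 ^+ 2 :> R by ring.
  by rewrite lerXn2r ?nnegrE ?expR_ge0.
have dk : delta^-1 <= 4 ^+ k.
  by apply: le_trans e4; rewrite -[delta^-1]lnK ?posrE ?invr_gt0 // ler_expR ltW.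
have k4 : k.+1%:R <= 4 ^+ k :> R by rewrite -natrX ler_nat ltn_expl.
split.
  rewrite ler_pdivrMr ?exprn_gt0 // (_ : 16 = 4 * 4 :> R); last by ring.
  rewrite exprMn mulrA (le_trans k4) // ler_peMl ?exprn_ge0 //.
  rewrite -(ler_pM2l (_ : 0 < delta^-1)) ?invr_gt0 // mulr1 mulrA.
  by rewrite mulVf ?gt_eqF // mul1r.
by rewrite /k -!natr1; lra.
Qed.

Lemma beta_estimation (t : nat) (delta : R) (post : R -> R) :
  (0 < t)%N -> 0 < delta < 1 ->
  exists A : qalg R d b, [/\ qalg_wf A,
    (queries A)%:R <= 4 * (t%:R * h%:R * (1 + ln delta^-1)) &
    forall X (P : R -> bool),
      (forall o, `|o - rf_beta F X| <= 4 / t%:R -> P (post o)) ->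
      1 - delta <= success_prob A X P].
Proof.
move=> t0 /repetitions [k [kd kl]].
have D0 : 0 < ymax F - ymin F by rewrite subr_gt0.
pose f y := 1 - 2 * ((y - ymin F) / (ymax F - ymin F)).
(* A cosine is required for every real, including the default label of an inner node, so [f] is cut
   off; on tree outputs [g] and [f] agree. *)
pose g y := if f y ^+ 2 <= 1 then f y else 1.
have g1 y : g y ^+ 2 <= 1 by rewrite /g; case: ifP => //; rewrite expr1n.
have [A [wfA qA sA]] := mean_estimation (Ordinal d_gt0) n_gt0 height_F g1 k t0
  (fun o => post ((1 - o) / 2)).
exists A; split=> // [|X P okP].
  rewrite qA natrM natrD.
  apply: (@le_trans _ _ ((k.+1 * t)%:R * (h%:R + h%:R))).
    by rewrite ler_wpM2r ?addr_ge0 // ler_nat leq_pred.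
  have := ler_wpM2r (mulr_ge0 (ler0n R t) (ler0n R h)) kl; rewrite natrM; lra.
apply: le_trans (sA X P _); first by rewrite lerD2l lerN2.
have meanE : mean F g X = 1 - 2 * rf_beta F X.
  have gE i : g (dt_eval X (F i)) = f (dt_eval X (F i)).
    rewrite /g ifT //; have := dt_eval_scaled_bounds X i.
    by rewrite /f; move: (_ / _) => z /andP [z0 z1]; nra.
  rewrite /mean /rf_beta; under eq_bigr do rewrite gE.
  rewrite /f sumrB -mulr_sumr sumr_const card_ord mulrBr mulVf ?pnatr_eq0 -?lt0n //.
  by rewrite mulrCA.
move=> o; rewrite meanE => close; apply: okP.
(* The map [o -> (1 - o) / 2] halves the error [8 / t]. *)
rewrite (_ : _ - rf_beta F X = - ((o - (1 - 2 * rf_beta F X)) / 2)); last by field.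
by rewrite normrN normrM [`|2^-1|]ger0_norm ?invr_ge0 //; lra.
Qed.

(** Serves the case of part (ii) where the tolerance exceeds the whole range of predictions. *)
Lemma constant_output (y : R) : exists A : qalg R d b, [/\ qalg_wf A, queries A = 0%N &
  forall X (P : R -> bool), P y -> success_prob A X P = 1].
Proof.
pose s0 : qbasis d b unit := (Ordinal d_gt0, blank b, tt).
have [A [wfA qA sA]] := qalg_of_implements s0 (fun=> y)
  (implements_free (@lin_isom_id R (qbasis d b unit))).
exists A; split=> // X P Py; rewrite sA Py (bigD1 s0) //= big1 => [|s /negPf ss].
  by rewrite /basis_state eqxx addr0 /sqmod /= expr1n expr0n addr0.
by rewrite /basis_state ss /sqmod /= expr0n addr0.
Qed.
End Forest.

Theorem theorem1 (R : realType) :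
  exists C : R, 0 < C /\
  forall (n d b h : nat) (F : 'I_n -> dtree R d b),
    (0 < n)%N -> (0 < d)%N ->
    (forall i, (dt_height (F i) <= h)%N) ->
    ymin F < ymax F ->
    forall (t : nat) (delta : R), (0 < t)%N -> 0 < delta < 1 ->
    (exists A : qalg R d b,
        qalg_wf A /\
        (queries A)%:R <= C * (t%:R * h%:R * (1 + ln (delta^-1))) /\
        forall X : object d b,
          success_prob A X
            (fun o => `|o - rf_beta F X| <= 2 * pi / t%:R + pi ^+ 2 / t%:R ^+ 2)
          >= 1 - delta)
    /\
    (let Tc : R := (Num.ceil (t%:R * (ymax F - ymin F)))%:~R in
     exists A : qalg R d b,
        qalg_wf A /\
        (queries A)%:R
          <= C * (t%:R * (ymax F - ymin F) * h%:R * (1 + ln (delta^-1))) /\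
        forall X : object d b,
          success_prob A X
            (fun o => `|o - rf_predict F X|
                      <= (ymax F - ymin F) * (2 * pi / Tc + pi ^+ 2 / Tc ^+ 2))
          >= 1 - delta).
Proof.
(* The 4 of [beta_estimation], doubled by rounding up to [T] in part (ii). *)
exists 8; split=> // n d b h F n0 d0 hF ylt t delta t0 delta01.
have [dl0 dl1] := andP delta01.
have t0R : 0 < t%:R :> R by rewrite ltr0n.
have D0 : 0 < ymax F - ymin F by rewrite subr_gt0.
have l0 : 0 <= ln delta^-1 by rewrite ln_ge0 // invf_ge1 // ltW.
have tol (s : R) : 0 < s -> 4 / s <= 2 * pi / s + pi ^+ 2 / s ^+ 2.
  move=> s0; rewrite -[leLHS]addr0 lerD //; last by rewrite divr_ge0 ?sqr_ge0.
  by rewrite ler_pM2r ?invr_gt0 //; have := pi_ge2 R; lra.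
split.
  have [A [wfA qA sA]] := beta_estimation n0 d0 hF ylt id t0 delta01.
  exists A; split=> //; split.
    apply: le_trans qA _; rewrite ler_wpM2r ?mulr_ge0 ?addr_ge0 //; lra.
  by move=> X; apply: sA => o /le_trans -> //; exact: tol.
move=> Tc; set x := t%:R * _ in Tc *.
have x0 : 0 < x by rewrite mulr_gt0.
have ceil0 : 0 < Num.ceil x by rewrite ceil_gt0.
pose T := `|Num.ceil x|%N.
have TcE : Tc = T%:R by rewrite /Tc /T -[X in X%:~R]gez0_abs // ltW.
have T0 : (0 < T)%N by rewrite /T absz_gt0 gt_eqF.
have T0R : 0 < T%:R :> R by rewrite ltr0n.
have xT : T%:R < x + 1.
  by have := ceilB1_lt x; rewrite intrB -/Tc TcE; lra.
(* For [x <= 1] the ceiling is 1 and the tolerance is at least four times the label range, so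
   answering [ymin F] is correct. Otherwise [T < x + 1 < 2 x]. *)
have [x1|x1] := leP x 1.
  have [A [wfA qA sA]] := constant_output b d0 (ymin F).
  exists A; split=> //; split.
    rewrite qA; apply: mulr_ge0 => //.
    by rewrite mulr_ge0 ?addr_ge0 // mulr_ge0 // ltW.
  move=> X; rewrite sA; first by lra.
  have T1 : Tc = 1.
    rewrite TcE; suff /eqP -> : T == 1%N by []; rewrite eqn_leq T0 andbT -ltnS.
    by rewrite -(ltr_nat R) (lt_le_trans xT) // lerD2r.
  have /andP [beta0 beta1] := rf_beta_bounds n0 ylt X.
  rewrite rf_predict_beta // opprD addNKr normrN normrM (gtr0_norm D0).
  rewrite ler_pM2l // ger0_norm //.
  rewrite (le_trans beta1) // (le_trans _ (tol _ _)) ?T1 //; lra.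
have [A [wfA qA sA]] :=
  beta_estimation n0 d0 hF ylt (fun o => ymin F + (ymax F - ymin F) * o) T0 delta01.
exists A; split=> //; split.
  apply: le_trans qA _.
  have T2x : T%:R <= 2 * x by lra.
  have hl0 : 0 <= h%:R * (1 + ln delta^-1) by rewrite mulr_ge0 ?addr_ge0.
  have := ler_wpM2r hl0 T2x; lra.
move=> X; apply: sA => o close; rewrite rf_predict_beta //.
rewrite (_ : _ - _ = (ymax F - ymin F) * (o - rf_beta F X)); last by ring.
rewrite normrM (gtr0_norm D0) ler_pM2l // TcE.
by rewrite (le_trans close) // tol.
Qed.
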